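(* Let $a,b\ge 0$ with $a+b>0$, let $\mathbf A=\begin{pmatrix}-a&b\\ a&-b\end{pmatrix}$, and let $\mathbf y^*>\mathbf 0$ be an arbitrary steady state of $\mathbf y'=\mathbf A\mathbf y$, i.e. $\mathbf A\mathbf y^*=\mathbf 0$. Consider the MPRK22($\alpha$) schemes, $\alpha\ge\frac12$, applied to $\mathbf y'=\mathbf A\mathbf y$. a) The MPRK22($\alpha$) schemes are unconditionally stable, in the sense that any $\mathbf y^*$ is a stable fixed point of the MPRK22($\alpha$) schemes independent of the time step size $\Delta t$. b) For every MPRK22($\alpha$) scheme there exists a $\delta>0$, such that $\lVert\mathbf y^0\rVert_1=\lVert\mathbf y^*\rVert_1$ and $\lVert\mathbf y^0-\mathbf y^*\rVert<\delta$ imply $\mathbf y^n\to\mathbf y^*$ as $n\to\infty$ independent of the time step size $\Delta t$.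
   Context: $\mathbb R^2_{>0}$ is the set of vectors in $\mathbb R^2$ with both components positive, and $\mathbf y^*>\mathbf 0$ means $\mathbf y^*\in\mathbb R^2_{>0}$; $\lVert\cdot\rVert$ is an arbitrary norm on $\mathbb R^2$ and $\lVert\cdot\rVert_1$ is the 1-norm. (A steady state $\mathbf y^*>\mathbf 0$ exists only if $a,b>0$.) The system $\mathbf y'=\mathbf A\mathbf y$ is regarded as the production-destruction system $y_i'=\sum_{j=1}^2(p_{ij}(\mathbf y)-d_{ij}(\mathbf y))$, $i=1,2$, with $p_{12}(\mathbf y)=d_{21}(\mathbf y)=by_2$, $p_{21}(\mathbf y)=d_{12}(\mathbf y)=ay_1$, $p_{ii}(\mathbf y)=d_{ii}(\mathbf y)=0$. For $\alpha\ge\frac12$ and time step size $\Delta t>0$, the MPRK22($\alpha$) scheme computes $\mathbf y^{n+1}$ from $\mathbf y^n\in\mathbb R^2_{>0}$ by the linearly implicit formulas, for $i=1,2$, $$y_i^{(1)}=y_i^n,$$ $$y_i^{(2)}=y_i^n+\alpha\Delta t\sum_{j=1}^2\Bigl(p_{ij}(\mathbf y^{(1)})\frac{y_j^{(2)}}{y_j^{(1)}}-d_{ij}(\mathbf y^{(1)})\frac{y_i^{(2)}}{y_i^{(1)}}\Bigr),$$ $$y_i^{n+1}=y_i^n+\Delta t\sum_{j=1}^2\Bigl(\bigl((1-\tfrac1{2\alpha})p_{ij}(\mathbf y^{(1)})+\tfrac1{2\alpha}p_{ij}(\mathbf y^{(2)})\bigr)\frac{y_j^{n+1}}{(y_j^{(2)})^{1/\alpha}(y_j^{(1)})^{1-1/\alpha}}-\bigl((1-\tfrac1{2\alpha})d_{ij}(\mathbf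 y^{(1)})+\tfrac1{2\alpha}d_{ij}(\mathbf y^{(2)})\bigr)\frac{y_i^{n+1}}{(y_i^{(2)})^{1/\alpha}(y_i^{(1)})^{1-1/\alpha}}\Bigr).$$ The scheme can be written as an iteration $\mathbf y^{n+1}=\mathbf g(\mathbf y^n)$ with a map $\mathbf g\colon\mathbb R^2_{>0}\to\mathbb R^2_{>0}$ (depending on $\alpha$, $\Delta t$, $a$, $b$), started from $\mathbf y^0\in\mathbb R^2_{>0}$; a fixed point of the scheme is a fixed point of $\mathbf g$. A fixed point $\mathbf y^*$ is called (Lyapunov) stable if for every $\epsilon>0$ there exists $\delta=\delta(\epsilon)>0$ such that $\lVert\mathbf y^0-\mathbf y^*\rVert<\delta$ implies $\lVert\mathbf y^n-\mathbf y^*\rVert<\epsilon$ for all $n\ge0$. *)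

(* Defs.v *)
From HB Require Import structures.
From mathcomp Require Import all_boot all_order all_algebra.
From mathcomp Require Import ring lra.
From mathcomp Require Import all_classical all_reals all_analysis.
Set Implicit Arguments. Unset Strict Implicit. Unset Printing Implicit Defensive.
Import Order.TTheory GRing.Theory Num.Theory.
Import numFieldNormedType.Exports.
Local Open Scope ring_scope.

Record is_norm (R : realType) (N : nat) (nrm : 'cV[R]_N -> R) : Prop := IsNorm {
  is_norm_triangle : forall x y, nrm (x + y) <= nrm x + nrm y;
  is_norm_scale : forall c x, nrm (c *: x) = `|c| * nrm x;
  is_norm_definite : forall x, nrm x = 0 -> x = 0 }.

Definition norm1 (R : realType) (N : nat) (y : 'cV[R]_N) : R :=
  \sum_(i < N) `|y i 0|.

Definition posvec (R : realType) (N : nat) (y : 'cV[R]_N) : Prop :=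
  forall i, 0 < y i 0.

(* One step of MPRK22(alpha) for the production-destruction system
   y_i' = \sum_j (p_ij(y) - d_ij(y)).  The first stage is y itself; y2 is the
   second stage and y' the new iterate. Both equations are linear in their
   last argument. *)
Definition mprk22_stage2 (R : realType) (N : nat) (p d : 'cV[R]_N -> 'M[R]_N)
    (alpha dt : R) (y y2 : 'cV[R]_N) : Prop :=
  forall i, y2 i 0 = y i 0 + alpha * dt *
    \sum_(j < N) (p y i j * (y2 j 0 / y j 0) - d y i j * (y2 i 0 / y i 0)).

Definition mprk22_update (R : realType) (N : nat) (p d : 'cV[R]_N -> 'M[R]_N)
    (alpha dt : R) (y y2 y' : 'cV[R]_N) : Prop :=
  forall i, y' i 0 = y i 0 + dt *
    \sum_(j < N)
      (((1 - 1 / (2 * alpha)) * p y i j + 1 / (2 * alpha) * p y2 i j)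
         * (y' j 0 / (y2 j 0 `^ (1 / alpha) * y j 0 `^ (1 - 1 / alpha)))
       - ((1 - 1 / (2 * alpha)) * d y i j + 1 / (2 * alpha) * d y2 i j)
         * (y' i 0 / (y2 i 0 `^ (1 / alpha) * y i 0 `^ (1 - 1 / alpha)))).

Definition mprk22_step (R : realType) (N : nat) (p d : 'cV[R]_N -> 'M[R]_N)
    (alpha dt : R) (y y' : 'cV[R]_N) : Prop :=
  exists y2, mprk22_stage2 p d alpha dt y y2 /\
             mprk22_update p d alpha dt y y2 y'.

Definition Amx (R : realType) (a b : R) : 'M[R]_2 :=
  \matrix_(i, j) (if i == 0 then (if j == 0 then - a else b)
                  else (if j == 0 then a else - b)).

Definition prodA (R : realType) (a b : R) (y : 'cV[R]_2) : 'M[R]_2 :=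
  \matrix_(i, j) (if (i == 0) && (j == 1) then b * y 1 0
                  else if (i == 1) && (j == 0) then a * y 0 0
                  else 0).

Definition destA (R : realType) (a b : R) (y : 'cV[R]_2) : 'M[R]_2 :=
  (prodA a b y)^T.

(* The map g of the scheme y^{n+1} = g(y^n) for y' = Amx a b *m y. By
   mprk22_step_unique and mprk22_mapP below, on positive vectors it is the
   unique solution of the scheme and it is positive; elsewhere its value
   is irrelevant. *)
Definition mprk22_map (R : realType) (alpha dt a b : R) (y : 'cV[R]_2) :
    'cV[R]_2 :=
  xget 0 [set y' | mprk22_step (prodA a b) (destA a b) alpha dt y y']%classic.

(* Lyapunov stability of a fixed point of a map g of the positive vectors. *)
Definition stable_fixed_point (R : realType) (N : nat) (nrm : 'cV[R]_N -> R)
    (g : 'cV[R]_N -> 'cV[R]_N) (ystar : 'cV[R]_N) : Prop :=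
  g ystar = ystar /\
  forall eps : R, 0 < eps -> exists delta : R, 0 < delta /\
    forall y0, posvec y0 -> nrm (y0 - ystar) < delta ->
    forall n : nat, nrm (iter n g y0 - ystar) < eps.

Lemma sum_ord2 (R : realType) (F : 'I_2 -> R) : \sum_(j < 2) F j = F 0 + F 1.
Proof.
by rewrite !big_ord_recl big_ord0 addr0; congr (_ + F _); apply: val_inj.
Qed.

Lemma forall_ord2 (P : 'I_2 -> Prop) : P 0 -> P 1 -> forall i, P i.
Proof.
move=> P0 P1 i; have [->//|ni] := eqVneq i 0.
have -> // : i = 1.
by apply: val_inj; case: i ni => [[|[|]]].
Qed.

Lemma pds_Amx (R : realType) (a b : R) (y : 'cV[R]_2) (i : 'I_2) :
  \sum_(j < 2) (prodA a b y i j - destA a b y i j) = (Amx a b *m y) i 0.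
Proof.
rewrite mxE !sum_ord2; move: i; apply: forall_ord2; rewrite !mxE /=; ring.
Qed.

(* Both implicit equations of the scheme for y' = Amx a b *m y have this form. *)
Definition exchange (R : realType) (B C : R) (c x : 'cV[R]_2) : Prop :=
  x 0 0 = c 0 0 + B * x 1 0 - C * x 0 0 /\
  x 1 0 = c 1 0 + C * x 0 0 - B * x 1 0.

Lemma exchange_ex (R : realType) (B C : R) (c : 'cV[R]_2) :
  0 <= B -> 0 <= C -> posvec c -> exists x, posvec x /\ exchange B C c x.
Proof.
move=> B0 C0 cp; have D0 : 0 < 1 + B + C by lra.
have c0 := cp 0; have c1 := cp 1.
exists (\col_i ((c i 0 + (if i == 0 then B else C) * (c 0 0 + c 1 0))
                  / (1 + B + C))).
split; last by rewrite /exchange !mxE /=; split; field; exact: lt0r_neq0.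
move=> i; rewrite mxE divr_gt0 // ltr_wpDr //.
by apply: mulr_ge0; [case: ifP | apply: addr_ge0; exact: ltW].
Qed.

Lemma exchange_unique (R : realType) (B C : R) (c x z : 'cV[R]_2) :
  0 <= B -> 0 <= C -> exchange B C c x -> exchange B C c z -> x = z.
Proof.
move=> B0 C0 [x0 x1] [z0 z1]; have D0 : 1 + B + C != 0.
  by apply: lt0r_neq0; lra.
have s : x 0 0 + x 1 0 = z 0 0 + z 1 0 by lra.
have e0 : x 0 0 = z 0 0 by apply: (mulfI D0); nra.
apply/matrixP => i j; rewrite ord1; move: i; apply: forall_ord2 => //; lra.
Qed.

Section Step.
Context (R : realType) (alpha dt a b : R).
Implicit Types y : 'cV[R]_2.

Local Notation stage2 := (mprk22_stage2 (prodA a b) (destA a b) alpha dt).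
Local Notation update := (mprk22_update (prodA a b) (destA a b) alpha dt).
Local Notation step := (mprk22_step (prodA a b) (destA a b) alpha dt).

Lemma stage2E y y2 : posvec y ->
  stage2 y y2 <-> exchange (alpha * dt * b) (alpha * dt * a) y y2.
Proof.
move=> yp; have y0 := lt0r_neq0 (yp 0); have y1 := lt0r_neq0 (yp 1).
have E0 : y 0 0 + alpha * dt * \sum_(j < 2) (prodA a b y 0 j *
    (y2 j 0 / y j 0) - destA a b y 0 j * (y2 0 0 / y 0 0))
    = y 0 0 + alpha * dt * b * y2 1 0 - alpha * dt * a * y2 0 0.
  by rewrite sum_ord2 !mxE /=; field; rewrite y0 y1.
have E1 : y 1 0 + alpha * dt * \sum_(j < 2) (prodA a b y 1 j *
    (y2 j 0 / y j 0) - destA a b y 1 j * (y2 1 0 / y 1 0))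
    = y 1 0 + alpha * dt * a * y2 0 0 - alpha * dt * b * y2 1 0.
  by rewrite sum_ord2 !mxE /=; field; rewrite y0 y1.
split=> [h|[h0 h1]]; first by split; [rewrite -E0 -h | rewrite -E1 -h].
apply: forall_ord2; [by rewrite E0 | by rewrite E1].
Qed.

Let w y y2 (i : 'I_2) : R :=
  ((1 - 1 / (2 * alpha)) * y i 0 + 1 / (2 * alpha) * y2 i 0)
  / (y2 i 0 `^ (1 / alpha) * y i 0 `^ (1 - 1 / alpha)).

Lemma updateE y y2 y' :
  update y y2 y' <-> exchange (dt * b * w y y2 1) (dt * a * w y y2 0) y y'.
Proof.
rewrite /w.
set s := fun i : 'I_2 => y2 i 0 `^ (1 / alpha) * y i 0 `^ (1 - 1 / alpha).
rewrite /mprk22_update /exchange -/(s 0) -/(s 1).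
set A := 1 - 1 / (2 * alpha); set B := 1 / (2 * alpha).
have E0 : y 0 0 + dt * \sum_(j < 2)
   ((A * prodA a b y 0 j + B * prodA a b y2 0 j) * (y' j 0 / s j) -
    (A * destA a b y 0 j + B * destA a b y2 0 j) * (y' 0 0 / s 0)) =
   y 0 0 + dt * b * ((A * y 1 0 + B * y2 1 0) / s 1) * y' 1 0
         - dt * a * ((A * y 0 0 + B * y2 0 0) / s 0) * y' 0 0.
  rewrite sum_ord2 !mxE /=; ring.
have E1 : y 1 0 + dt * \sum_(j < 2)
   ((A * prodA a b y 1 j + B * prodA a b y2 1 j) * (y' j 0 / s j) -
    (A * destA a b y 1 j + B * destA a b y2 1 j) * (y' 1 0 / s 1)) =
   y 1 0 + dt * a * ((A * y 0 0 + B * y2 0 0) / s 0) * y' 0 0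
         - dt * b * ((A * y 1 0 + B * y2 1 0) / s 1) * y' 1 0.
  rewrite sum_ord2 !mxE /=; ring.
split=> [h|[h0 h1]].
  by split; [rewrite -E0 -h | rewrite -E1 -h].
apply: forall_ord2; [by rewrite E0 | by rewrite E1].
Qed.

Context (ha : 0 <= a) (hb : 0 <= b) (halpha : 1 / 2 <= alpha) (hdt : 0 < dt).

Let w_ge0 y y2 i : posvec y -> posvec y2 -> 0 <= w y y2 i.
Proof.
move=> yp y2p; have al0 : 0 < alpha by have := halpha; lra.
have B0 : 0 <= 1 / (2 * alpha) by rewrite divr_ge0 //; lra.
have A0 : 0 <= 1 - 1 / (2 * alpha).
  have a2 : 0 < 2 * alpha by lra.
  by rewrite subr_ge0 ler_pdivrMr // mul1r; have := halpha; lra.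
by apply: divr_ge0; [apply: addr_ge0|]; apply: mulr_ge0;
  rewrite ?powR_ge0 // ltW.
Qed.

Let rate_ge0 y y2 c i : 0 <= c -> posvec y -> posvec y2 ->
  0 <= dt * c * w y y2 i.
Proof.
move=> c0 yp y2p; apply: mulr_ge0; last exact: w_ge0.
by apply: mulr_ge0 => //; exact: ltW.
Qed.

Let stage2_ex y : posvec y -> exists y2, posvec y2 /\ stage2 y y2.
Proof.
move=> yp; have al0 : 0 <= alpha * dt.
  by apply: mulr_ge0; have := halpha; have := hdt; lra.
have [y2 [y2p h]] :=
  exchange_ex (mulr_ge0 al0 hb) (mulr_ge0 al0 ha) yp.
by exists y2; split=> //; apply/stage2E.
Qed.

Let stage2_unique y y2 z2 : posvec y ->
  stage2 y y2 -> stage2 y z2 -> y2 = z2.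
Proof.
move=> yp; have al0 : 0 <= alpha * dt.
  by apply: mulr_ge0; have := halpha; have := hdt; lra.
move=> /stage2E h1 /stage2E h2.
by apply: exchange_unique (h1 yp) (h2 yp); apply: mulr_ge0.
Qed.

Lemma mprk22_step_ex y : posvec y -> exists y', posvec y' /\ step y y'.
Proof.
move=> yp; have [y2 [y2p h2]] := stage2_ex yp.
have B0 : 0 <= dt * b * w y y2 1 by apply: rate_ge0.
have C0 : 0 <= dt * a * w y y2 0 by apply: rate_ge0.
have [y' [y'p h]] := exchange_ex B0 C0 yp.
by exists y'; split=> //; exists y2; split=> //; apply/updateE.
Qed.

Lemma mprk22_step_unique y y' z' : posvec y ->
  step y y' -> step y z' -> y' = z'.
Proof.
move=> yp [y2 [h2 /updateE h]] [z2 [k2 /updateE k]].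
have [x2 [x2p l2]] := stage2_ex yp.
move: h k; rewrite (stage2_unique yp h2 l2) (stage2_unique yp k2 l2) => h k.
by apply: exchange_unique h k; apply: rate_ge0.
Qed.

Lemma mprk22_mapP y : posvec y ->
  posvec (mprk22_map alpha dt a b y) /\ step y (mprk22_map alpha dt a b y).
Proof.
move=> yp; have [y' [y'p h]] := mprk22_step_ex yp.
rewrite /mprk22_map (xget_unique _ h) // => z /= hz.
exact: mprk22_step_unique yp hz h.
Qed.

End Step.

(* Main.v *)
Require Import Defs.
From mathcomp Require Import all_boot all_order all_algebra.
From mathcomp Require Import ring lra.
From mathcomp Require Import all_classical all_reals all_analysis.
Set Implicit Arguments.
Unset Strict Implicit.
Unset Printing Implicit Defensive.
Import Order.TTheory GRing.Theory Num.Theory.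
Import numFieldNormedType.Exports.
Local Open Scope classical_set_scope.
Local Open Scope ring_scope.

(** Both implicit equations of the scheme only move quantities between the two
    components, so [y 0 0 + y 1 0] is conserved and the dynamics is governed by
    the quotient of the relative coordinates [X = y 0 0 / ystar 0 0] and
    [Z = y 1 0 / ystar 1 0], which equals 1 exactly at the steady state of the
    given amount.  Write [T] for the amount of [y] divided by that of [ystar],
    a weighted mean of [X] and [Z], and [l = dt * (a + b)].  Solving the two
    linear systems gives [X2 = (X + alpha l T) / (1 + alpha l)] for the second
    stage, likewise [Z2], and

      X' / Z' = (X + l * wZ * T) / (Z + l * wX * T),

    where [wX = weight (1 / (2 alpha)) (X2 / X)], and likewise [wZ].

    Say [Z <= T <= X <= 2 Z].  Then [X2 / X] lies in [1/2, 1] and [Z2 / Z] in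
    [1, 2].  There the elementary inequalities for [weight] yield
    [wZ <= 1 <= wX], which bounds [X' / Z'] from above by its value for weights
    1, and [wX / wZ <= (Z2 / Z) / (X2 / X)], which bounds [Z' / X'] by
    [(X / Z) (Z2 / X2)].  Consequently, if both quotients of [X] and [Z] are at
    most [1 + v] with [v <= 1], then both quotients of [X'] and [Z'] are at
    most [1 + k v], with [k < 1] the larger of [1 / (1 + l)] and
    [alpha l / (1 + alpha l)] (lemmas [relative_step_contraction] and
    [balanced_mprk22_map]).

    Only [k] depends on [alpha] and [dt], whereas the region of contraction
    [v <= 1] does not; hence the neighbourhood in the second claim can be chosen
    before the time step.  Working with the quotient [X / Z] is essential for
    this: for [alpha = 1/2] and [dt] tending to infinity the map tends to
    [X / Z |-> Z / X], an isometry in [ln (X / Z)], while for [a <> b] it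
    increases the distance to the steady state from one side of it. *)

(** * The Patankar weight near 1 *)

Lemma ln_ge_1Binv (R : realType) (x : R) : 0 < x -> 1 - x^-1 <= ln x.
Proof.
move=> x0; have := @le_ln1Dx R (x^-1 - 1).
rewrite addrCA subrr addr0 lnV ?posrE // => h.
by rewrite -lerN2 opprB h // ltrBrDl subrr invr_gt0.
Qed.

Lemma ln_le_B1 (R : realType) (x : R) : 0 < x -> ln x <= x - 1.
Proof.
by move=> x0; rewrite -{1}[x](subrK 1) addrC le_ln1Dx // ltrBrDl subrr.
Qed.

Lemma mean_gt0 (R : realType) (d r : R) :
  0 <= d -> d <= 1 -> 0 < r -> 0 < 1 - d + d * r.
Proof. by move=> d0 d1 r0; have [->|/eqP] := eqVneq d 1; nra. Qed.

(** Weighted arithmetic-geometric mean inequality between 1 and [r], weakened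
    by [r `^ (2 * d) <= r `^ d]. *)
Lemma powR_le_mean (R : realType) (d r : R) :
  0 <= d -> d <= 1 -> 0 < r -> r <= 1 -> r `^ (2 * d) <= 1 - d + d * r.
Proof.
move=> d0 d1 r0 r1; have m0 := mean_gt0 d0 d1 r0.
set m := 1 - d + d * r in m0 *.
rewrite -ler_ln ?posrE ?powR_gt0 // ln_powR.
have ln0 := ln_le0 r1.
suff : d * ln r <= ln m by nra.
(* Concavity of ln: [ln t <= t - 1] at [t = 1 / m] and [t = r / m], averaged
   with weights [1 - d] and [d], where the right-hand sides cancel. *)
have h1 := ln_le_B1 (divr_gt0 r0 m0).
have h2 := ln_le_B1 (divr_gt0 ltr01 m0).
rewrite !ln_div ?posrE // ln1 in h1 h2.
have e : (1 - d) * (1 / m - 1) + d * (r / m - 1) = 0.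
  by rewrite /m; field; exact: lt0r_neq0.
nra.
Qed.

(** Exponentiating [2 * d * ln r >= d * (r - 1)]; the bound
    [ln r >= (r - 1) / 2] follows from [ln r >= 1 - 1 / r] if [r <= 2]. *)
Lemma mean_le_powR (R : realType) (d r : R) :
  0 <= d -> 1 <= r -> r <= 2 -> 1 - d + d * r <= r `^ (2 * d).
Proof.
move=> d0 r1 r2; have r0 : 0 < r by lra.
rewrite /powR gt_eqF //; apply: le_trans (expR_ge1Dx _).
have := ln_ge_1Binv r0.
have : (r - 1) / 2 <= 1 - r^-1.
  rewrite -subr_ge0.
  have -> : 1 - r^-1 - (r - 1) / 2 = (r - 1) * (2 - r) / (2 * r).
    by field; exact: lt0r_neq0.
  by apply: divr_ge0; nra.
nra.
Qed.

(** The Patankar weight of a component multiplied by the factor [r] in the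
    second stage, with [d = 1 / (2 * alpha)] (see [weight_stageE]). *)
Definition weight (R : realType) (d r : R) : R :=
  (1 - d + d * r) / r `^ (2 * d).

Lemma weight_gt0 (R : realType) (d r : R) :
  0 <= d -> d <= 1 -> 0 < r -> 0 < weight d r.
Proof. by move=> *; rewrite divr_gt0 ?mean_gt0 ?powR_gt0. Qed.

(** A symmetry of the weight; it turns bounds for [weight] into bounds for
    [r * weight d r]. *)
Lemma weight_inv (R : realType) (d r : R) :
  0 < r -> r * weight d r = weight (1 - d) r^-1.
Proof.
move=> r0; have rn0 := lt0r_neq0 r0; rewrite /weight.
have -> : r^-1 `^ (2 * (1 - d)) = r `^ (2 * d) / r ^+ 2.
  rewrite -powR_inv1 ?ltW // -powRrM -powR_mulrn ?ltW //.
  rewrite -powRB ?rn0 ?implybT //.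
  by congr (_ `^ _); ring.
by field; rewrite rn0 lt0r_neq0 ?powR_gt0.
Qed.

Lemma weight_ge1 (R : realType) (d r : R) :
  0 <= d -> d <= 1 -> 0 < r -> r <= 1 -> 1 <= weight d r.
Proof.
by move=> *; rewrite ler_pdivlMr ?powR_gt0 // mul1r powR_le_mean.
Qed.

Lemma weight_le1 (R : realType) (d r : R) :
  0 <= d -> 1 <= r -> r <= 2 -> weight d r <= 1.
Proof.
move=> d0 r1 r2.
by rewrite ler_pdivrMr ?powR_gt0 ?mul1r ?mean_le_powR //; lra.
Qed.

Lemma mul_weight_le1 (R : realType) (d r : R) :
  d <= 1 -> 1 / 2 <= r -> r <= 1 -> r * weight d r <= 1.
Proof.
move=> d1 r2 r1; have r0 : 0 < r by lra.
rewrite weight_inv // weight_le1 ?subr_ge0 ?invf_ge1 //.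
by rewrite -div1r ler_pdivrMr //; lra.
Qed.

Lemma mul_weight_ge1 (R : realType) (d r : R) :
  0 <= d -> d <= 1 -> 1 <= r -> 1 <= r * weight d r.
Proof.
move=> d0 d1 r1; have r0 : 0 < r by lra.
by rewrite weight_inv // weight_ge1 ?invr_gt0 ?invf_le1 //; lra.
Qed.

(** The weight only depends on [z / y] because numerator and denominator are
    both homogeneous of degree 1 in [(y, z)]. *)
Lemma weight_stageE (R : realType) (al y z : R) : 0 < al -> 0 < y -> 0 < z ->
  ((1 - 1 / (2 * al)) * y + 1 / (2 * al) * z) /
    (z `^ (1 / al) * y `^ (1 - 1 / al)) = weight (1 / (2 * al)) (z / y).
Proof.
move=> al0 y0 z0; have [yn zn] := (lt0r_neq0 y0, lt0r_neq0 z0).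
have aln := lt0r_neq0 al0; rewrite /weight.
have -> : 2 * (1 / (2 * al)) = 1 / al by field.
have -> : z `^ (1 / al) * y `^ (1 - 1 / al) = (z / y) `^ (1 / al) * y.
  rewrite powRB ?yn ?implybT // powRr1 ?ltW // powRM ?invr_ge0 ?ltW //.
  rewrite -[y^-1]powR_inv1 ?ltW // -powRrM mulN1r powRN.
  by rewrite -!mulrA; congr (_ * _); rewrite mulrC.
have p0 : (z / y) `^ (1 / al) != 0 by rewrite lt0r_neq0 ?powR_gt0 ?divr_gt0.
by field; rewrite p0 yn aln.
Qed.

(** * Contraction in relative coordinates *)

Section RelativeStep.
Context (R : realType) (al l d : R).
Hypotheses (al0 : 0 < al) (l0 : 0 < l) (d0 : 0 <= d) (d1 : d <= 1).

(** The factor by which the second stage multiplies the relative coordinate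
    [X]. *)
Let stage (T X : R) : R := (X + al * l * T) / (1 + al * l) / X.

(** [NX] and [NZ] are the new relative coordinates up to a common positive
    factor.  The first bound replaces both weights by 1, which leaves
    [(X - Z) / (Z + l * T)], at most [v / (1 + l)].  The second one compares
    the weights through [r * weight d r], and the quotient of the stage factors
    exceeds 1 by at most [v * (al * l / (1 + al * l))]. *)
Lemma relative_step_contraction (T X Z v k : R) : 0 < Z -> Z <= T -> T <= X ->
  X <= (1 + v) * Z -> v <= 1 -> 0 <= k ->
  1 <= k * (1 + l) -> al * l <= k * (1 + al * l) ->
  let NX := X + l * weight d (stage T Z) * T in
  let NZ := Z + l * weight d (stage T X) * T in
  NX <= (1 + k * v) * NZ /\ NZ <= (1 + k * v) * NX.
Proof.
move=> Z0 ZT TX XZ v1 k0 k1 k2 /=.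
have T0 : 0 < T by lra. have X0 : 0 < X by lra.
have [Xn Zn] := (lt0r_neq0 X0, lt0r_neq0 Z0).
have m0 : 0 < al * l by apply: mulr_gt0.
have m1 : 0 < 1 + al * l by lra.
have m1n := lt0r_neq0 m1.
have v0 : 0 <= v by nra.
have mT : al * l * Z <= al * l * T by rewrite ler_wpM2l // ltW.
have mT' : al * l * T <= al * l * X by rewrite ler_wpM2l // ltW.
have mT0 : 0 < al * l * T by apply: mulr_gt0.
have s0 : 0 < stage T X by rewrite !divr_gt0 //; lra.
have sge : 1 / 2 <= stage T X.
  rewrite /stage ler_pdivlMr // ler_pdivlMr //; nra.
have sle : stage T X <= 1.
  rewrite /stage ler_pdivrMr // ler_pdivrMr //; nra.
have tge : 1 <= stage T Z.
  rewrite /stage ler_pdivlMr // ler_pdivlMr //; nra.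
have tle : stage T Z <= 2.
  rewrite /stage ler_pdivrMr // ler_pdivrMr //; nra.
(* Over the common denominator [X * Z * (1 + al * l)] the claim becomes
   [al * l * T * (X - Z) <= k * v * Z * (X + al * l * T)]. *)
have st : stage T Z <= (1 + k * v) * stage T X.
  have -> : stage T Z = (X * (Z + al * l * T)) / (X * Z * (1 + al * l)).
    by rewrite /stage; field; rewrite Xn Zn m1n.
  have -> : (1 + k * v) * stage T X =
      ((1 + k * v) * (Z * (X + al * l * T))) / (X * Z * (1 + al * l)).
    by rewrite /stage; field; rewrite Xn Zn m1n.
  rewrite ler_pM2r ?invr_gt0 ?mulr_gt0 //.
  have h1 : al * l * T * (X - Z) <= al * l * (T * (v * Z)).
    by rewrite -!mulrA ler_pM2l // ler_pM2l // ler_pM2l //; lra.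
  have h2 : al * l * (T * (v * Z)) <= k * v * (Z * (X + al * l * T)).
    have -> : k * v * (Z * (X + al * l * T)) = v * Z * (k * (X + al * l * T)).
      by ring.
    have -> : al * l * (T * (v * Z)) = v * Z * (al * l * T) by ring.
    apply: ler_wpM2l; first by nra.
    apply: le_trans (_ : k * (1 + al * l) * T <= _); first by nra.
    by rewrite -mulrA ler_wpM2l //; nra.
  nra.
have wX1 := weight_ge1 d0 d1 s0 sle.
have wZ1 := weight_le1 d0 tge tle.
have wX2 := mul_weight_le1 d1 sge sle.
have wZ2 := mul_weight_ge1 d0 d1 tge.
have t0 : 0 < stage T Z by lra.
have wZ0 := weight_gt0 d0 d1 t0.
set wX := weight d (stage T X) in wX1 wX2 *.
set wZ := weight d (stage T Z) in wZ1 wZ2 wZ0 *.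
have kv0 : 0 <= k * v by apply: mulr_ge0.
have lT0 : 0 < l * T by apply: mulr_gt0.
split.
  have h1 : v * Z <= k * v * (Z + l * T).
    apply: le_trans (_ : v * (k * (1 + l) * Z) <= _); first by nra.
    rewrite [leRHS](_ : _ = v * (k * (Z + l * T))); last by ring.
    rewrite ler_wpM2l // -mulrA ler_wpM2l //; nra.
  have h2 : l * T * wZ <= l * T by nra.
  have h3 : (1 + k * v) * (l * T) <= (1 + k * v) * (l * T * wX).
    rewrite ler_wpM2l //; nra.
  nra.
have h : wX <= (1 + k * v) * wZ.
  apply: le_trans (_ : stage T Z * wZ * wX <= _); first by nra.
  apply: le_trans (_ : (1 + k * v) * stage T X * wZ * wX <= _).
    by rewrite ler_wpM2r ?ler_wpM2r //; nra.
  rewrite [leLHS](_ : _ = (1 + k * v) * wZ * (stage T X * wX)); last by ring.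
  rewrite ler_piMr //; nra.
have h' : l * T * wX <= l * T * ((1 + k * v) * wZ) by rewrite ler_wpM2l // ltW.
nra.
Qed.
End RelativeStep.

(** * Equivalence of norms *)

Section NormEquivalence.
Context (R : realType) (N : nat) (nrm : 'cV[R]_N -> R) (hnrm : is_norm nrm).

Lemma is_norm0 : nrm 0 = 0.
Proof. by rewrite -(scale0r 0) (is_norm_scale hnrm) normr0 mul0r. Qed.

Lemma is_normN x : nrm (- x) = nrm x.
Proof. by rewrite -scaleN1r (is_norm_scale hnrm) normrN1 mul1r. Qed.

Lemma is_norm_ge0 x : 0 <= nrm x.
Proof.
have := is_norm_triangle hnrm x (- x).
rewrite subrr is_norm0 is_normN; lra.
Qed.

(** Expansion in the canonical basis: [C] is the sum of the norms of the basis
    vectors, increased by 1 to be positive also in dimension 0. *)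
Lemma is_norm_le_coord : exists2 C : R, 0 < C &
  forall (x : 'cV[R]_N) e, 0 <= e -> (forall i, `|x i 0| <= e) ->
    nrm x <= C * e.
Proof.
pose C := \sum_(i < N) nrm (delta_mx i 0).
have C0 : 0 <= C by apply: sumr_ge0 => i _; exact: is_norm_ge0.
exists (C + 1) => [|x e e0 xe]; first by lra.
have nrm_sum (F : 'I_N -> 'cV[R]_N) : nrm (\sum_i F i) <= \sum_i nrm (F i).
  elim/big_ind2 : _ => [|u s v t us vt|//]; first by rewrite is_norm0.
  by apply: le_trans (is_norm_triangle hnrm _ _) _; exact: lerD.
apply: le_trans (_ : C * e <= _); last by rewrite ler_wpM2r // lerDl.
rewrite [in leLHS](matrix_sum_delta x) /C mulr_suml.
apply: le_trans (nrm_sum _) _; apply: ler_sum => i _.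
rewrite big_ord1 (is_norm_scale hnrm) mulrC.
by rewrite ler_wpM2l ?is_norm_ge0.
Qed.

(** The norm is Lipschitz for the maximum norm, hence attains a positive
    minimum on the compact unit sphere; homogeneity does the rest. *)
Lemma coord_le_is_norm : exists2 c : R, 0 < c &
  forall (x : 'cV[R]_N) i, c * `|x i 0| <= nrm x.
Proof.
have [C C0 hC] := is_norm_le_coord.
have coord_le (v : 'rV[R]_N) i : `|v 0 i| <= `|v|.
  rewrite [leRHS]/Num.Def.normr /= mx_normrE.
  by apply/bigmax_geP; right; exists (0, i).
(* Transposed, as [bounded_closed_compact] is about row vectors. *)
pose f (v : 'rV[R]_N) := nrm v^T.
have fC v : f v <= C * `|v| by apply: hC => // i; rewrite mxE.
have f_lip u v : `|f u - f v| <= C * `|u - v|.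
  have fB s t : f s - f t <= C * `|s - t|.
    rewrite lerBlDl; apply: le_trans (_ : f t + f (s - t) <= _).
      apply: le_trans (is_norm_triangle hnrm _ _).
      by rewrite -linearD /= addrC subrK.
    by rewrite lerD2l.
  by rewrite ler_norml fB andbT lerNl opprB distrC fB.
have f_cont : continuous f.
  move=> u; apply/(@cvgrPdist_le _ _ _ _ (nbhs_filter u)) => e e0; near=> v.
  apply: le_trans (f_lip _ _) _.
  rewrite mulrC -ler_pdivlMr //.
  near: v; apply: cvgr_dist_le; [exact: cvg_id | exact: divr_gt0].
pose S := [set v : 'rV[R]_N | `|v| = 1].
have S_compact : compact S.
  apply: bounded_closed_compact.
    exists 1; split => // M M1 v /= ->; exact: ltW.
  apply: (@preimage_closed _ _ (fun v : 'rV[R]_N => `|v|) [set x | x = 1]).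
    by move=> v _; exact: norm_continuous.
  exact: closed_eq.
have f_lower : exists2 c, 0 < c & forall v, c * `|v| <= f v.
  have [S0|/eqP/set0P S0] := pselect (S = set0).
    (* The sphere is empty in dimension 0, where every vector is null. *)
    exists 1 => // v; have [->|vn] := eqVneq `|v| 0.
      by rewrite mulr0 is_norm_ge0.
    have : S (`|v|^-1 *: v) by rewrite /S /= normrZ normfV normr_id mulVf.
    by rewrite S0.
  have [u uS hu] := EVT_min_rV S0 S_compact (continuous_subspaceT f_cont).
  have fu : 0 < f u.
    rewrite lt_neqAle is_norm_ge0 andbT eq_sym; apply/eqP.
    move=> /(is_norm_definite hnrm) u0.
    move: uS; rewrite inE /S /= -[u]trmxK u0 trmx0 normr0 => /esym/eqP.
    by rewrite oner_eq0.
  exists (f u) => // v; have [v0|vn] := eqVneq `|v| 0.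
    by rewrite v0 mulr0 is_norm_ge0.
  have v0 : 0 < `|v| by rewrite lt_neqAle eq_sym vn normr_ge0.
  rewrite -ler_pdivlMr //.
  have -> : f v / `|v| = f (`|v|^-1 *: v).
    by rewrite /f linearZ /= (is_norm_scale hnrm) normfV normr_id mulrC.
  by apply: hu; rewrite inE /S /= normrZ normfV normr_id mulVf.
have [c c0 hc] := f_lower.
exists c => // x i; apply: le_trans (_ : c * `|x^T| <= _).
  by rewrite ler_pM2l //; have := coord_le x^T i; rewrite mxE.
by apply: le_trans (hc _) _; rewrite /f trmxK.
Unshelve. all: by end_near.
Qed.
End NormEquivalence.

(** * One step of the scheme *)

Definition amount (R : realType) (y : 'cV[R]_2) : R := y 0 0 + y 1 0.

Lemma exchangeE (R : realType) (B C : R) (c x : 'cV[R]_2) : exchange B C c x ->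
  [/\ amount x = amount c,
      (1 + B + C) * x 0 0 = c 0 0 + B * amount c &
      (1 + B + C) * x 1 0 = c 1 0 + C * amount c].
Proof. by rewrite /amount => -[e0 e1]; split; nra. Qed.

Section Scheme.
Context (R : realType) (a b : R) (ystar : 'cV[R]_2).
Implicit Types y : 'cV[R]_2.
Hypotheses (ha : 0 <= a) (hb : 0 <= b) (hab : 0 < a + b).
Hypotheses (hpos : posvec ystar) (hsteady : Amx a b *m ystar = 0).

Let rel (y : 'cV[R]_2) i : R := y i 0 / ystar i 0.

(** The value of both relative coordinates at the steady state with the same
    amount as [y]. *)
Let mass (y : 'cV[R]_2) : R := amount y / amount ystar.

(** Closeness to the line of steady states, on which both relative coordinates
    coincide; it is insensitive to the amount of [y]. *)
Definition balanced (v : R) (y : 'cV[R]_2) : Prop :=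
  y 0 0 / ystar 0 0 <= (1 + v) * (y 1 0 / ystar 1 0) /\
  y 1 0 / ystar 1 0 <= (1 + v) * (y 0 0 / ystar 0 0).

Let amount_gt0 y : posvec y -> 0 < amount y.
Proof. by move=> yp; apply: addr_gt0. Qed.

(** The steady state determines the rates up to time scale, which lets it
    replace them in the exchange equations. *)
Let rates : exists kappa : R, a = kappa * ystar 1 0 /\ b = kappa * ystar 0 0.
Proof.
have s0 := hpos 0; have s1 := hpos 1; have S0 := amount_gt0 hpos.
have e : a * ystar 0 0 = b * ystar 1 0.
  have /matrixP/(_ 1 0) := hsteady; rewrite !mxE sum_ord2 !mxE /=; lra.
exists ((a + b) / amount ystar); split.
  apply: (mulIf (lt0r_neq0 S0)); rewrite mulrAC divfK ?lt0r_neq0 // /amount; lra.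
apply: (mulIf (lt0r_neq0 S0)); rewrite mulrAC divfK ?lt0r_neq0 // /amount; lra.
Qed.

Let mass_mean y :
  (ystar 0 0 + ystar 1 0) * mass y = ystar 0 0 * rel y 0 + ystar 1 0 * rel y 1.
Proof.
have s0 := lt0r_neq0 (hpos 0); have s1 := lt0r_neq0 (hpos 1).
have := lt0r_neq0 (amount_gt0 hpos); rewrite /mass /rel /amount => S0.
by field; rewrite s0 s1 S0.
Qed.

Let mass_between y i j : rel y i <= rel y j -> i != j ->
  rel y i <= mass y /\ mass y <= rel y j.
Proof.
have s0 := hpos 0; have s1 := hpos 1; have := mass_mean y.
move: i j; apply: forall_ord2; apply: forall_ord2 => // m h _.
  split; nra.
split; nra.
Qed.

(** Both linear systems solved in relative coordinates: [h = al * dt] with unit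
    weights is the second stage, [h = dt] the update.  The weights end up
    crossed, that of the second component driving the first one. *)
Let rel_exchange h w0 w1 y x :
  exchange (h * b * w1) (h * a * w0) y x ->
  let D := 1 + h * b * w1 + h * a * w0 in
  D * rel x 0 = rel y 0 + h * (a + b) * w1 * mass y /\
  D * rel x 1 = rel y 1 + h * (a + b) * w0 * mass y.
Proof.
have [kappa [-> ->]] := rates.
have s0 := lt0r_neq0 (hpos 0); have s1 := lt0r_neq0 (hpos 1).
have := lt0r_neq0 (amount_gt0 hpos).
move=> S0 /exchangeE[_ e0 e1] D; rewrite /mass /rel.
rewrite !mulrA e0 e1; rewrite /amount in S0 *.
by split; field; rewrite ?s0 ?s1 S0.
Qed.

Lemma amount_mprk22_map al dt y : 1 / 2 <= al -> 0 < dt -> posvec y ->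
  amount (mprk22_map al dt a b y) = amount y.
Proof.
move=> al2 dt0 yp.
have [_ [y2 [_ /updateE/exchangeE[-> _ _]]]] := mprk22_mapP ha hb al2 dt0 yp.
by [].
Qed.

(** [relative_step_contraction], applied with the larger relative coordinate
    as [X]. *)
Lemma balanced_mprk22_map al dt k v y : 1 / 2 <= al -> 0 < dt ->
  0 <= k -> 1 <= k * (1 + dt * (a + b)) ->
  al * (dt * (a + b)) <= k * (1 + al * (dt * (a + b))) ->
  v <= 1 -> posvec y -> balanced v y ->
  balanced (k * v) (mprk22_map al dt a b y).
Proof.
move=> al2 dt0 k0 k1 k2 v1 yp [b0 b1].
have al0 : 0 < al by lra.
have l0 : 0 < dt * (a + b) by apply: mulr_gt0.
have d0 : 0 <= 1 / (2 * al) by rewrite divr_ge0 //; lra.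
have d1 : 1 / (2 * al) <= 1 by rewrite ler_pdivrMr ?mul1r //; lra.
have [gp [y2 [h2 /updateE h]]] := mprk22_mapP ha hb al2 dt0 yp.
move: h2 => /(stage2E _ _ _ _ _ yp) h2.
set g := mprk22_map _ _ _ _ _ in gp h *.
have [r0 r1] : (1 + al * (dt * (a + b))) * rel y2 0
     = rel y 0 + al * (dt * (a + b)) * mass y /\
  (1 + al * (dt * (a + b))) * rel y2 1
     = rel y 1 + al * (dt * (a + b)) * mass y.
  have := @rel_exchange (al * dt) 1 1 y y2; rewrite !mulr1 => /(_ h2) /=.
  by rewrite -!mulrA -addrA -!mulrDr [b + a]addrC.
have L0 : 0 < 1 + al * (dt * (a + b)) by have := mulr_gt0 al0 l0; lra.
have relp z i : posvec z -> 0 < rel z i by move=> zp; apply: divr_gt0.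
have mp : 0 < mass y by apply: divr_gt0; apply: amount_gt0.
have stageE i : y2 i 0 / y i 0 =
    (rel y i + al * (dt * (a + b)) * mass y) / (1 + al * (dt * (a + b)))
      / rel y i.
  have -> : rel y i + al * (dt * (a + b)) * mass y
            = (1 + al * (dt * (a + b))) * rel y2 i.
    by move: i; apply: forall_ord2.
  have [yi si] := (lt0r_neq0 (yp i), lt0r_neq0 (hpos i)).
  rewrite /rel; field; rewrite yi si; exact: lt0r_neq0.
have y2p : posvec y2.
  move=> i; have : 0 < y2 i 0 / y i 0.
    rewrite stageE !divr_gt0 ?relp //.
    by apply: addr_gt0; [exact: relp | apply: mulr_gt0 => //; exact: mulr_gt0].
  by rewrite pmulr_lgt0 // invr_gt0.
rewrite !weight_stageE // !stageE in h.
have [] := rel_exchange h.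
set w1 := weight _ _; set w0 := weight _ _.
have w00 : 0 < w0.
  by rewrite weight_gt0 // -stageE divr_gt0.
have w10 : 0 < w1.
  by rewrite weight_gt0 // -stageE divr_gt0.
have : 0 < 1 + dt * b * w1 + dt * a * w0.
  have := mulr_ge0 (mulr_ge0 (ltW dt0) hb) (ltW w10).
  have := mulr_ge0 (mulr_ge0 (ltW dt0) ha) (ltW w00).
  lra.
set D := 1 + _ + _ => D0 e0 e1.
suff [] : D * rel g 0 <= (1 + k * v) * (D * rel g 1) /\
          D * rel g 1 <= (1 + k * v) * (D * rel g 0).
  by rewrite ![(1 + k * v) * (D * _)]mulrCA !ler_pM2l.
rewrite e0 e1.
have [le01|/ltW le10] := leP (rel y 1) (rel y 0).
  have [m0 m1] := mass_between le01 isT.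
  exact: (relative_step_contraction al0 l0 d0 d1 (relp y 1 yp) m0 m1 b0).
have [m0 m1] := mass_between le10 isT.
have [] := relative_step_contraction al0 l0 d0 d1 (relp y 0 yp) m0 m1 b1 v1 k0 k1 k2.
by split.
Qed.

(** Taking the larger of the two quotients uses [0 < a + b] and [0 < dt] to stay
    below 1; the rate degrades both for small and for large time steps. *)
Lemma contraction_factor al dt : 0 < al -> 0 < dt -> exists k,
  [/\ 0 <= k, k < 1, 1 <= k * (1 + dt * (a + b)) &
      al * (dt * (a + b)) <= k * (1 + al * (dt * (a + b)))].
Proof.
move=> al0 dt0; have l0 : 0 < dt * (a + b) by apply: mulr_gt0.
have m0 := mulr_gt0 al0 l0; set l := dt * (a + b) in l0 m0 *.
have L0 : 0 < 1 + l by lra. have M0 : 0 < 1 + al * l by lra.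
exists (Num.max (1 + l)^-1 (al * l / (1 + al * l))); split.
- by rewrite le_max invr_ge0 ltW.
- rewrite gt_max invf_lt1 // ltr_pdivrMr //; apply/andP; split; lra.
- by rewrite -ler_pdivrMr // div1r le_max lexx.
- by rewrite -ler_pdivrMr // le_max lexx orbT.
Qed.

Lemma balanced_iter al dt k v y n : 1 / 2 <= al -> 0 < dt ->
  0 <= k -> k < 1 -> 1 <= k * (1 + dt * (a + b)) ->
  al * (dt * (a + b)) <= k * (1 + al * (dt * (a + b))) ->
  0 <= v -> v <= 1 -> posvec y -> balanced v y ->
  let yn := iter n (mprk22_map al dt a b) y in
  [/\ posvec yn, amount yn = amount y & balanced (k ^+ n * v) yn].
Proof.
move=> al2 dt0 k0 k1 k2 k3 v0 v1 yp yb.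
elim: n => [|n [np nt nb]] /=; first by rewrite mul1r.
have kn1 : k ^+ n * v <= 1.
  by apply: mulr_ile1; rewrite ?exprn_ge0 // exprn_ile1 // ltW.
split; first by case: (mprk22_mapP ha hb al2 dt0 np).
  by rewrite amount_mprk22_map.
by rewrite exprS -mulrA; apply: balanced_mprk22_map.
Qed.

(** Together with conservation of the amount this turns contraction towards
    the line of steady states into distances to [ystar]. *)
Lemma balanced_dist v y i : 0 <= v -> posvec y -> balanced v y ->
  `|y i 0 - ystar i 0| <=
  (`|amount y / amount ystar - 1| + v * (amount y / amount ystar)) * ystar i 0.
Proof.
move=> v0 yp [b0 b1]; have si := hpos i; rewrite -/(mass y).
have mp : 0 < mass y by apply: divr_gt0; apply: amount_gt0.
suff h : `|rel y i - mass y| <= v * mass y.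
  have -> : y i 0 - ystar i 0 = (rel y i - 1) * ystar i 0.
    by rewrite /rel mulrBl mul1r divfK ?lt0r_neq0.
  rewrite normrM (gtr0_norm si) ler_pM2r //.
  rewrite (_ : rel y i - 1 = (mass y - 1) + (rel y i - mass y)); last by lra.
  by apply: le_trans (ler_normD _ _) _; rewrite lerD2l.
rewrite ler_distl.
rewrite -!/(rel y _) in b0 b1.
move: i {si}; have [le01|/ltW le10] := leP (rel y 1) (rel y 0).
  have [m0 m1] := mass_between le01 isT.
  by apply: forall_ord2; apply/andP; split; nra.
have [m0 m1] := mass_between le10 isT.
by apply: forall_ord2; apply/andP; split; nra.
Qed.

(** The slack 4 comes from [1 + eta <= (1 + 4 * eta) * (1 - eta)], true for
    [eta <= 1 / 2]; the bound [1 / 4] keeps [4 * eta] in the region of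
    contraction. *)
Lemma near_balanced eta y : 0 < eta -> eta <= 1 / 4 ->
  (forall i, `|y i 0 - ystar i 0| <= eta * ystar i 0) ->
  balanced (4 * eta) y /\ `|amount y / amount ystar - 1| <= eta.
Proof.
move=> eta0 eta4 hy.
have hr i : 1 - eta <= rel y i /\ rel y i <= 1 + eta.
  have si := hpos i; have := hy i; rewrite ler_distl => /andP[h1 h2].
  by rewrite /rel ler_pdivlMr // ler_pdivrMr //; split; nra.
have [l0 u0] := hr 0; have [l1 u1] := hr 1.
split; first by rewrite /balanced -!/(rel y _); split; nra.
rewrite -/(mass y) ler_distl.
have s0 := hpos 0; have s1 := hpos 1; have := mass_mean y.
have [le01|/ltW le10] := leP (rel y 1) (rel y 0).
  by have [m0 m1] := mass_between le01 isT => _; apply/andP; split; lra.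
by have [m0 m1] := mass_between le10 isT => _; apply/andP; split; lra.
Qed.

End Scheme.

(** * Stability and convergence *)

Lemma norm1_posvec (R : realType) (y : 'cV[R]_2) :
  posvec y -> norm1 y = amount y.
Proof. by move=> yp; rewrite /norm1 sum_ord2 !gtr0_norm. Qed.

Lemma is_norm_near (R : realType) (nrm : 'cV[R]_2 -> R) (ystar : 'cV[R]_2) eta :
  is_norm nrm -> posvec ystar -> 0 < eta -> exists2 delta, 0 < delta &
  forall y, nrm (y - ystar) < delta ->
    forall i, `|y i 0 - ystar i 0| <= eta * ystar i 0.
Proof.
move=> hnrm hpos eta0; have [c c0 hc] := coord_le_is_norm hnrm.
have s0 := hpos 0; have s1 := hpos 1.
pose m := Num.min (ystar 0 0) (ystar 1 0).
have m0 : 0 < m by rewrite lt_min s0 s1.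
have ms i : m <= ystar i 0.
  by move: i; apply: forall_ord2; rewrite ge_min lexx ?orbT.
exists (c * (eta * m)) => [|y hy i]; first by rewrite !mulr_gt0.
apply: le_trans (_ : eta * m <= _); last by rewrite ler_pM2l.
rewrite -(ler_pM2l c0) ltW //; have := hc (y - ystar) i.
by rewrite !mxE => /le_lt_trans; apply.
Qed.

Lemma cvg_geometric_coord (R : realType) (N : nat) (u : nat -> 'cV[R]_N)
    (l : 'cV[R]_N) (k C : R) : 0 <= k -> k < 1 ->
  (forall n i, `|u n i 0 - l i 0| <= C * k ^+ n) -> u @ \oo --> l.
Proof.
move=> k0 k1 hu; apply/cvgrPdist_le => e e0.
have kn : `|k| < 1 by rewrite ger0_norm.
have small := cvgr_dist_le _ _ (cvg_geometric C kn) _ e0.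
near=> n.
rewrite /Num.Def.normr /= mx_normrE.
apply: (bigmax_le _ (ltW e0)) => -[i j] _ /=.
rewrite !mxE ord1 distrC; apply: le_trans (hu n i) _.
have : `|0 - geometric C k n| <= e by near: n; exact: small.
by rewrite /= sub0r normrN; apply: le_trans; exact: ler_norm.
Unshelve. all: by end_near.
Qed.

Theorem corollary3p9 (R : realType) (a b : R) (ystar : 'cV[R]_2)
    (nrm : 'cV[R]_2 -> R)
    (ha : 0 <= a) (hb : 0 <= b) (hab : 0 < a + b)
    (hnrm : is_norm nrm)
    (hpos : posvec ystar) (hsteady : Amx a b *m ystar = 0) :
  (forall alpha dt : R, 1 / 2 <= alpha -> 0 < dt ->
     stable_fixed_point nrm (mprk22_map alpha dt a b) ystar)
  /\
  (forall alpha : R, 1 / 2 <= alpha ->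
     exists delta : R, 0 < delta /\
       forall dt : R, 0 < dt ->
       forall y0 : 'cV[R]_2, posvec y0 ->
         norm1 y0 = norm1 ystar -> nrm (y0 - ystar) < delta ->
         (fun n : nat => iter n (mprk22_map alpha dt a b) y0) @ \oo --> ystar).
Proof.
have S0 : 0 < amount ystar by apply: addr_gt0.
have sS i : ystar i 0 <= amount ystar.
  have := hpos 0; have := hpos 1; rewrite /amount.
  by move: i; apply: forall_ord2 => *; lra.
split=> [alpha dt al2 dt0|alpha al2].
  have al0 : 0 < alpha by lra.
  have [k [k0 k1 k2 k3]] := contraction_factor hab al0 dt0.
  split.
    (* [ystar] is balanced with [v = 0], and so is its image; since the image
       has the same amount, it is [ystar]. *)
    have b0 : balanced ystar 0 ystar.
      by rewrite /balanced !divff ?lt0r_neq0 //; split; lra.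
    have [gp _] := mprk22_mapP ha hb al2 dt0 hpos.
    have gb := balanced_mprk22_map ha hb hab hpos hsteady al2 dt0 k0 k2 k3
      ler01 hpos b0.
    rewrite mulr0 in gb.
    apply/matrixP => i j; rewrite ord1; apply/eqP; rewrite -subr_eq0 -normr_le0.
    apply: le_trans (balanced_dist hpos i (lexx 0) gp gb) _.
    rewrite amount_mprk22_map // divff ?lt0r_neq0 //.
    by rewrite subrr normr0 mul0r add0r mul0r.
  move=> eps eps0; have [C C0 hC] := is_norm_le_coord hnrm.
  (* All iterates keep the amount of [y], which costs [eta], and stay balanced
     with [4 * eta], which costs at most [4 * eta * (5 / 4)]: in total
     [6 * eta], relative to each component. *)
  pose eta := Num.min (1 / 4) (eps / (12 * C * amount ystar)).
  have D0 : 0 < 12 * C * amount ystar by rewrite !mulr_gt0.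
  have eta0 : 0 < eta.
    by rewrite lt_min; apply/andP; split; [lra | exact: divr_gt0].
  have eta4 : eta <= 1 / 4 by rewrite ge_min lexx.
  have etae : C * (6 * eta * amount ystar) < eps.
    have : eta <= eps / (12 * C * amount ystar) by rewrite ge_min lexx orbT.
    rewrite ler_pdivlMr //; nra.
  have [delta d0 hd] := is_norm_near hnrm hpos eta0.
  exists delta; split=> // y yp /hd /(near_balanced hpos eta0 eta4) [yb yt] n.
  have v0 : 0 <= 4 * eta by lra.
  have v1 : 4 * eta <= 1 by lra.
  have [np nt nb] :=
    balanced_iter ha hb hab hpos hsteady n al2 dt0 k0 k1 k2 k3 v0 v1 yp yb.
  apply: le_lt_trans etae; apply: hC => [|i]; first by rewrite !mulr_ge0 // ltW.
  have kn0 : 0 <= k ^+ n by rewrite exprn_ge0.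
  have kn1 : k ^+ n <= 1 by rewrite exprn_ile1 // ltW.
  have kv0 : 0 <= k ^+ n * (4 * eta) by rewrite mulr_ge0.
  rewrite !mxE; apply: le_trans (balanced_dist hpos i kv0 np nb) _; rewrite nt.
  have si := ltW (hpos i).
  apply: le_trans (_ : 6 * eta * ystar i 0 <= _); last first.
    by rewrite ler_wpM2l //; lra.
  apply: ler_wpM2r => //.
  move: yt; set t := amount y / _ => yt.
  have t0 : 0 <= t by rewrite ltW // divr_gt0 // addr_gt0.
  have t1 : t <= 5 / 4 by move: yt; rewrite ler_distl => /andP[_]; lra.
  have kv4 : k ^+ n * (4 * eta) <= 4 * eta by rewrite ler_piMl.
  have := ler_pM kv0 t0 kv4 t1; lra.
(* The largest neighbourhood on which [near_balanced] reaches [v <= 1]; it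
   is fixed before [dt]. *)
have e4 : 0 < 1 / 4 :> R by lra.
have [delta d0 hd] := is_norm_near hnrm hpos e4.
exists delta; split=> // dt dt0 y yp yS.
move=> /hd /(near_balanced hpos e4 (lexx _)) [yb _].
have al0 : 0 < alpha by lra.
have [k [k0 k1 k2 k3]] := contraction_factor hab al0 dt0.
have v0 : 0 <= 4 * (1 / 4) :> R by lra.
have v1 : 4 * (1 / 4) <= 1 :> R by lra.
apply: (@cvg_geometric_coord _ _ _ _ k (amount ystar)) => // n i.
have [np nt nb] :=
  balanced_iter ha hb hab hpos hsteady n al2 dt0 k0 k1 k2 k3 v0 v1 yp yb.
have kn0 : 0 <= k ^+ n by rewrite exprn_ge0.
have kv0 : 0 <= k ^+ n * (4 * (1 / 4)) by rewrite mulr_ge0.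
apply: le_trans (balanced_dist hpos i kv0 np nb) _.
rewrite !norm1_posvec // in yS.
rewrite nt yS divff ?lt0r_neq0 // subrr normr0 add0r mulr1.
have := sS i; have -> : 4 * (1 / 4) = 1 :> R by lra.
by rewrite mulr1 mulrC => h; apply: ler_wpM2r.
Qed.
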